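(* Let $(\gamma_n)_{n\ge1}\subset[-1/2,1/2]$ and $(\eta_n)_{n\ge1}\subset\{x\in\mathbb R^d:\|x\|_2\le1/B\}$ be predictable, with associated processes $L_n^{\rm C,2steps}(\gamma)$ and $W_n^{\rm C,2steps}$ as defined in the context. Assume that the regret $$\mathcal R_n:=\max_{\gamma\in[-1/2,1/2]}\log L_n^{\rm C,2steps}(\gamma)-\log W_n^{\rm C,2steps}$$ of the betting strategy $(\gamma_n)_{n\ge1}$ and the stochastic regret $$\mathcal S_n:=\sup_{\|\eta\|_2\le1/B}\sum_{t=1}^n\mathbb E_{t-1}[\eta^\top X_t]-\sum_{t=1}^n\mathbb E_{t-1}[\eta_t^\top X_t]$$ of $(\eta_n)_{n\ge1}$ satisfy respectively $\rho:=\sum_{n\ge1}\mathbb P[\mathcal R_n>r_n]<+\infty$ and $\varsigma:=\sum_{n\ge1}\mathbb P[\mathcal S_n>s_n]<+\infty$ for some nonnegative sequences $(r_n)_{n\ge1}$ and $(s_n)_{n\ge1}$. Let $(m_n)_{n\ge1}$, $(v_n)_{n\ge1}$ be nonnegative sequences and suppose that $$\varrho_{2,2}:=\sum_{n\ge1}\mathbb P\big(\|\mu_n\|_2<m_n\ \text{or}\ \nu_{n,2}>v_n\big)<+\infty .$$ Set $$u_n:=\frac{(nm_n-s_n)_+}{4}\left(1\wedge\frac{(nm_n-s_n)_+}{4n\,v_n}\right)-4\log(n)-r_n .$$ Then $$\sum_{n\ge1}\mathbb P[\log W_n^{\rm C,2steps}<u_n]\le\rho+\varrho_{2,2}+\varsigma+\frac{\pi^2}{3}<+\infty.$$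 Hence $\liminf_{n\to+\infty}\frac{\log W_n^{\rm C,2steps}}{u_n}\ge1$ $\mathbb P$-a.s., and for any $\alpha\in(0,1)$, $$\mathbb E[\tau_\alpha^{\rm C,2steps}]\le\rho+\varrho_{2,2}+\varsigma+\frac{\pi^2}{3}+\aleph\big((u_n)_{n\ge1},\log(1/\alpha)\big).$$
   Context: Let $(\Omega,\mathcal F,\mathbb P)$ be a probability space with filtration $(\mathcal F_t)_{t\in\mathbb N}$, and write $\mathbb E_{t-1}[\cdot]=\mathbb E[\cdot\mid\mathcal F_{t-1}]$. $(X_t)_{t\in\mathbb N}$ is an adapted process valued in a bounded set $\mathsf X\subset\mathbb R^d$, $d\ge1$, with $B:=\sup_{x\in\mathsf X}\|x\|_2$. Put $\mu_n:=\frac1n\sum_{t=1}^n\mathbb E_{t-1}[X_t]$ and $\nu_{n,2}:=\frac1n\sum_{t=1}^n\mathbb E_{t-1}[\|X_t\|_2^2]$. Predictable means that $\gamma_n,\eta_n$ are $\mathcal F_{n-1}$-measurable. For $\gamma\in[-1/2,1/2]$, $$L_n^{\rm C,2steps}(\gamma)=\prod_{t=1}^n(1+\gamma\,\eta_t^\top X_t),\qquad W_n^{\rm C,2steps}=\prod_{t=1}^n(1+\gamma_t\,\eta_t^\top X_t).$$ The sequences $(r_n)$, $(s_n)$, $(m_n)$, $(v_n)$ are deterministic. Also $\tau_\alpha^{\rm C,2steps}:=\inf\{n\in\mathbb N:W_n^{\rm C,2steps}\ge1/\alpha\}$, $\aleph((u_n)_{n\ge1},x):=\inf\{n\ge1:\inf_{k\ge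 n}u_k\ge x\}$ (with $\inf\emptyset=+\infty$), $z_+=\max(z,0)$ and $a\wedge b=\min(a,b)$.
   Formalization: The formal theorem assumes B ≤ 1, since the printed u_n contains no B and the bound fails for every B > 1, and it states the liminf claim only when u_n > 0 for all large n, since it fails for negative u_n. *)

(* Defs.v *)
From mathcomp Require Import all_boot all_order all_algebra.
From mathcomp Require Import all_classical all_reals all_analysis.

Set Implicit Arguments.
Unset Strict Implicit.
Unset Printing Implicit Defensive.

Import Order.TTheory GRing.Theory Num.Theory.
Import numFieldNormedType.Exports.

Local Open Scope classical_set_scope.
Local Open Scope ring_scope.

(* The norm that mathcomp-analysis puts on 'cV[R]_d is the sup norm, hence an
   explicit Euclidean norm. *)
Definition dotv (R : realType) (d : nat) (x y : 'cV[R]_d) : R :=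
  \sum_(i < d) x i 0 * y i 0.

Definition norm2 (R : realType) (d : nat) (x : 'cV[R]_d) : R :=
  Num.sqrt (\sum_(i < d) x i 0 ^+ 2).

Definition norm_bound (R : realType) (d : nat) (D : set 'cV[R]_d) : R :=
  sup [set norm2 x | x in D].

(* {x : |x|_2 <= 1/B}; the product form agrees with this when B > 0 and is the
   convention 1/0 = +oo when B = 0. *)
Definition dual_ball (R : realType) (d : nat) (B : R) : set 'cV[R]_d :=
  [set x | B * norm2 x <= 1].

Section Conditioning.
Context (R : realType) (disp : measure_display) (T : measurableType disp).

Definition filtration (F : nat -> set (set T)) : Prop :=
  [/\ forall n, sigma_algebra [set: T] (F n),
      forall n, F n `<=` measurable
    & forall n k, (n <= k)%N -> F n `<=` F k].

Definition measurable_wrt (G : set (set T)) (f : T -> R) : Prop :=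
  forall A : set R, measurable A -> G (f @^-1` A).

(* Borel measurability in R^d is measurability of the coordinates. *)
Definition measurable_vec_wrt (d : nat) (G : set (set T)) (f : T -> 'cV[R]_d)
    : Prop :=
  forall i : 'I_d, measurable_wrt G (fun w => f w i 0).

(* Z is a version of the conditional expectation E[Y | G]. *)
Definition is_condexp (P : probability T R) (G : set (set T)) (Y Z : T -> R)
    : Prop :=
  [/\ measurable_wrt G Z,
      P.-integrable [set: T] (EFin \o Z)
    & forall A, G A ->
        (\int[P]_(w in A) (Z w)%:E = \int[P]_(w in A) (Y w)%:E)%E].

Definition is_condexp_vec (d : nat) (P : probability T R) (G : set (set T))
    (Y Z : T -> 'cV[R]_d) : Prop :=
  forall i : 'I_d, is_condexp P G (fun w => Y w i 0) (fun w => Z w i 0).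

End Conditioning.

Section Betting.
Context (R : realType) (T : Type) (d : nat).

(* In the definitions below, EX t, EX2 t and EetaX t stand for versions of
   E_{t-1}[X_t], E_{t-1}[|X_t|_2^2] and E_{t-1}[eta_t^T X_t]. *)

Definition mean_norm (EX : nat -> T -> 'cV[R]_d) (n : nat) (w : T) : R :=
  norm2 (n%:R^-1 *: \sum_(1 <= t < n.+1) EX t w).

Definition mean_sq (EX2 : nat -> T -> R) (n : nat) (w : T) : R :=
  n%:R^-1 * \sum_(1 <= t < n.+1) EX2 t w.

Definition wealth (X eta : nat -> T -> 'cV[R]_d) (gamma : nat -> T -> R)
    (n : nat) (w : T) : R :=
  \prod_(1 <= t < n.+1) (1 + gamma t w * dotv (eta t w) (X t w)).

Definition const_wealth (X eta : nat -> T -> 'cV[R]_d) (g : R)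
    (n : nat) (w : T) : R :=
  wealth X eta (fun _ _ => g) n w.

(* The maximum over [-1/2, 1/2] is written as a supremum; it is attained when
   the wealth is positive there, by continuity in g. *)
Definition regret (X eta : nat -> T -> 'cV[R]_d) (gamma : nat -> T -> R)
    (n : nat) (w : T) : R :=
  sup [set ln (const_wealth X eta g n w) | g in `[- 2^-1, 2^-1]%classic]
  - ln (wealth X eta gamma n w).

(* For deterministic h, dotv h (EX t w) is the version of E_{t-1}[h^T X_t] that
   is linear in h: versions have to be chosen coherently in h for the
   uncountable supremum to make sense. *)
Definition stoch_regret (EX : nat -> T -> 'cV[R]_d) (EetaX : nat -> T -> R)
    (B : R) (n : nat) (w : T) : R :=
  sup [set \sum_(1 <= t < n.+1) dotv h (EX t w) | h in @dual_ball R d B]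
  - \sum_(1 <= t < n.+1) EetaX t w.

Definition stopping (W : nat -> T -> R) (alpha : R) (w : T) : \bar R :=
  ereal_inf [set (n%:R)%:E | n in [set n : nat | alpha^-1 <= W n w]].

End Betting.

Definition aleph (R : realType) (u : nat -> R) (x : R) : \bar R :=
  ereal_inf [set (n%:R)%:E | n in [set n : nat | (1 <= n)%N /\
    (x%:E <= ereal_inf [set (u k)%:E | k in [set k : nat | (n <= k)%N]])%E]].

(* When v n = 0 the quotient a / (4 n v n) is read as +oo (if a = 0 the product
   vanishes whatever the quotient), whereas division by 0 gives 0 here.
   B does not enter this expression, which is a valid growth rate for log W_n
   only when B <= 1: since |eta_t|_2 <= 1/B, the drift of the eta_t^T X_t is of
   order n m n / B - s n. *)
Definition log_growth (R : realType) (r s m v : nat -> R) (n : nat) : R :=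
  let a := Num.max (n%:R * m n - s n) 0 in
  a / 4 * (if v n == 0 then 1 else Num.min 1 (a / (4 * n%:R * v n)))
  - 4 * ln n%:R - r n.

(* Main.v *)
Require Import Defs.
From mathcomp Require Import all_boot all_order all_algebra.
From mathcomp Require Import all_classical all_reals all_analysis.
From mathcomp Require Import measurable_realfun.
From mathcomp Require Import ring lra.

(** Write Z_t for eta_t^T X_t; the constraint B |eta_t| <= 1 gives |Z_t| <= 1.
    The proof compares log W_n with the log-wealth of one constant bet, chosen
    in advance from the deterministic sequences m, s and v.

    For g in [0, 1/2], the bet g B satisfies
    (1 + x)^(-1/2) <= 1 - x/2 + x^2 at x = g B Z_t, and x^2 <= g^2 |X_t|^2.
    The conditional expectation of the right-hand side is 1 + c_t with
    c_t = - g B/2 E_{t-1}[Z_t] + g^2 E_{t-1}[|X_t|^2], so the exponential of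
    - 1/2 log L_n(g B) - sum_t c_t is a nonnegative supermartingale of mean at
    most 1 ([integral_exp_supermartingale_le1]).  Markov's inequality at level
    n^2 gives, outside an event of probability at most 1/n^2,
      log L_n(g B) > g B sum_t E_{t-1}[Z_t]
                     - 2 g^2 sum_t E_{t-1}[|X_t|^2] - 4 log n.
    The linear functional h |-> h^T (sum_t E_{t-1}[X_t]) has supremum
    n |mu_n| / B over the dual ball, so a small stochastic regret and a large
    |mu_n| force sum_t E_{t-1}[Z_t] >= n m_n / B - s_n.  Since B <= 1 the lower
    bound becomes g a - 2 g^2 n v_n - 4 log n with a = n m_n - s_n, and g = 1/2
    or g = a / (8 n v_n) makes it at least u_n + r_n ([exists_bet_growth]).
    A regret of at most r_n then yields log W_n >= u_n
    ([log_growth_le_ln_wealth]).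

    The four exceptional events give the bound on P(log W_n < u_n), and
    summing 1/n^2 costs at most 2 <= pi^2/3.  The liminf statement is the
    Borel-Cantelli lemma.  For the stopping time, if u_n >= log(1/alpha) for
    all n >= N, then tau is at most N plus the number of n with log W_n < u_n,
    and one integrates ([integral_stopping_le]).

    Subadditivity of P needs all these events to be measurable although both
    regrets are suprema over uncountable sets: the first is reduced to
    countably many bets by continuity, the second has a closed form.  When
    B = 0 the supremum over the dual ball degenerates, but then X = 0 and
    mu_n = 0 almost surely. *)

Set Implicit Arguments.
Unset Strict Implicit.
Unset Printing Implicit Defensive.

Import Order.TTheory GRing.Theory Num.Theory.
Import numFieldNormedType.Exports.
Local Open Scope classical_set_scope.
Local Open Scope ring_scope.

(** * Sub-sigma-algebras and pulling out measurable factors *)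

Section SubSigmaAlgebra.
Context (R : realType) (disp : measure_display) (T : measurableType disp).
Variable G : set (set T).
Hypotheses (sG : sigma_algebra [set: T] G) (GS : G `<=` measurable).

(** Turns measurability with respect to a set of sets into measurability on a
    type, which gives access to the closure lemmas for measurable functions and
    to approximation by simple functions. *)
Lemma measurable_wrtE (f : T -> R) :
  measurable_wrt G f <->
  measurable_fun [set: g_sigma_algebraType G] (f : g_sigma_algebraType G -> R).
Proof.
split=> [mf _ A mA|mf A mA].
  by rewrite setTI; apply: sub_sigma_algebra; exact: mf.
by rewrite -[G](sigma_algebra_id sG) -[_ @^-1` A]setTI; exact: mf.
Qed.

Lemma measurable_wrt_measurable (f : T -> R) :
  measurable_wrt G f -> measurable_fun [set: T] f.
Proof. by move=> mf _ A mA; rewrite setTI; apply: GS; exact: mf. Qed.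

End SubSigmaAlgebra.

Section PullOut.
Context (R : realType) (disp : measure_display) (T : measurableType disp).
Variables (mu : {measure set T -> \bar R}) (G : set (set T)).
Hypotheses (sG : sigma_algebra [set: T] G) (GS : G `<=` measurable).
Import HBNNSimple.

Let fibreG (h : {nnsfun (g_sigma_algebraType G) >-> R}) y :
  G (h @^-1` [set y]).
Proof.
have : <<s G>> (h @^-1` [set y]).
  exact: (measurable_funPTI h (measurable_set1 y)).
by rewrite (sigma_algebra_id sG).
Qed.

Let integral_nnsfunM (h : {nnsfun (g_sigma_algebraType G) >-> R}) (U : T -> R) :
  measurable_fun [set: T] U -> (forall x, 0 <= U x) ->
  (\int[mu]_x (h x * U x)%:E = \sum_(y \in range h)
     (y%:E * \int[mu]_(x in h @^-1` [set y]) (U x)%:E))%E.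
Proof.
move=> mU U0.
have mh y : measurable (h @^-1` [set y] : set T).
  by apply: GS; exact: fibreG.
have mind y : measurable_fun [set: T] (fun x : T => \1_(h @^-1` [set y]) x : R).
  exact: measurable_indic.
transitivity (\int[mu]_x (\sum_(y \in range h)
    ((y * \1_(h @^-1` [set y]) x)%:E * (U x)%:E)))%E.
  apply: eq_integral => x _.
  by rewrite EFinM fimfunE -fsumEFin// ge0_mule_fsuml// => r;
    exact: nnfun_muleindic_ge0.
rewrite ge0_integral_fsum//; last 2 first.
- move=> y; apply/measurable_EFinP; apply: measurable_funM => //.
  exact: measurable_funM.
- move=> y x _; rewrite mule_ge0 ?lee_fin//.
  by rewrite -lee_fin EFinM nnfun_muleindic_ge0.
apply: eq_fsbigr => y /set_mem [t _ <-].
have ht0 : (0 <= h t)%R by [].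
under eq_integral do rewrite EFinM -muleA.
rewrite ge0_integralZl_EFin//; last 2 first.
- by move=> x _; rewrite mule_ge0 ?lee_fin.
- by apply/measurable_EFinP; exact: measurable_funM.
congr (_ * _)%E; rewrite [RHS]integral_mkcond.
by apply: eq_integral => x _; rewrite epatch_indic muleC.
Qed.

(* The approximating simple functions live on the type that carries G, so that
   their fibres belong to G, whereas the integral is over T. *)
Let integral_approxM (H U : T -> R)
    (mH : measurable_fun [set: g_sigma_algebraType G] (EFin \o H)) :
  (forall x, 0 <= H x) -> measurable_fun [set: T] U -> (forall x, 0 <= U x) ->
  (\int[mu]_x (nnsfun_approx measurableT mH n x * U x)%:E)%E @[n --> \oo] -->
  (\int[mu]_x (H x * U x)%:E)%E.
Proof.
move=> H0 mU U0.
have -> : (\int[mu]_x (H x * U x)%:E =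
    \int[mu]_x limn (fun n => (nnsfun_approx measurableT mH n x * U x)%:E))%E.
  apply: eq_integral => x _; apply/esym/cvg_lim => //.
  rewrite EFinM; under eq_fun do rewrite EFinM.
  apply: cvgeZr => //.
  have := @cvg_nnsfun_approx _ (g_sigma_algebraType G) R _ measurableT _ mH.
  by apply => //= y _; rewrite lee_fin.
apply: cvg_monotone_convergence => //.
- move=> n; apply/measurable_EFinP/measurable_funM => //.
  by apply: (measurable_wrt_measurable GS); exact/(measurable_wrtE sG).
- by move=> n x _; rewrite lee_fin mulr_ge0.
- move=> x _ a b ab; rewrite lee_fin ler_wpM2r//.
  by have /lefP := nd_nnsfun_approx measurableT mH ab; apply.
Qed.

(** Pulling a G-measurable factor out, in the form of an inequality: only the
    comparison of the integrals over sets of G is used, so that V may be a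
    majorant of a version of E[U | G], and H may be unbounded.  For simple H
    this is a weighted sum of the hypotheses over the fibres of H; monotone
    convergence does the rest. *)
Lemma ge0_integral_pullout_le (U V H : T -> R) :
  measurable_fun [set: T] U -> (forall x, 0 <= U x) ->
  measurable_fun [set: T] V -> (forall x, 0 <= V x) ->
  (forall A, G A ->
     \int[mu]_(x in A) (U x)%:E <= \int[mu]_(x in A) (V x)%:E)%E ->
  measurable_wrt G H -> (forall x, 0 <= H x) ->
  (\int[mu]_x (H x * U x)%:E <= \int[mu]_x (H x * V x)%:E)%E.
Proof.
move=> mU U0 mV V0 UV mH H0.
have mH' : measurable_fun [set: g_sigma_algebraType G] (EFin \o H).
  by apply/measurable_EFinP; exact/(measurable_wrtE sG).
have cU := integral_approxM mH' H0 mU U0.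
have cV := integral_approxM mH' H0 mV V0.
apply: (lee_cvg_to cU cV); apply: nearW => n.
rewrite !integral_nnsfunM//; apply: lee_fsum => // y [t _ <-].
by apply: lee_wpmul2l; [rewrite lee_fin|apply: UV; exact: fibreG].
Qed.

End PullOut.

(** * An exponential supermartingale *)

Section ExpSupermartingale.
Context (R : realType) (disp : measure_display) (T : measurableType disp).
Implicit Types (G : set (set T)) (P : probability T R).

Lemma measurable_wrt_sub G1 G2 (f : T -> R) :
  G1 `<=` G2 -> measurable_wrt G1 f -> measurable_wrt G2 f.
Proof. by move=> G12 mf A mA; apply: G12; exact: mf. Qed.

Lemma measurable_wrt_sum G (f : nat -> T -> R) n :
  sigma_algebra [set: T] G ->
  (forall t, (1 <= t <= n)%N -> measurable_wrt G (f t)) ->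
  measurable_wrt G (fun w => \sum_(1 <= t < n.+1) f t w).
Proof.
move=> sG mf; apply/(measurable_wrtE sG).
rewrite (_ : (fun w => _) = (fun w => \sum_(1 <= t < n.+1)
    (if (1 <= t <= n)%N then f t w else 0))); last first.
  apply/funext => w; apply: eq_big_nat => t.
  by rewrite ltnS => ->.
apply: measurable_sum => t.
have [tn|_] := boolP (1 <= t <= n)%N; last exact: measurable_cst.
by apply/(measurable_wrtE sG); exact: mf.
Qed.

Section Integral.
Variables (P : probability T R) (F : nat -> set (set T)) (hF : filtration F).
Variables xi U V : nat -> T -> R.
Hypothesis mxi : forall t, (1 <= t)%N -> measurable_wrt (F t) (xi t).
Hypothesis mU : forall t, (1 <= t)%N -> measurable_fun [set: T] (U t).
Hypothesis xiU : forall t w, (1 <= t)%N -> expR (xi t w) <= U t w.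
Hypothesis UV : forall t, (1 <= t)%N -> is_condexp P (F t.-1) (U t) (V t).

Let S n w := \sum_(1 <= t < n.+1) (xi t w - (V t w - 1)).

Let mS n : measurable_wrt (F n) (S n).
Proof.
have [sF _ Fle] := hF; apply: measurable_wrt_sum => // t /andP[t1 tn].
apply/(measurable_wrtE (sF n)); apply: measurable_funB.
  apply/(measurable_wrtE (sF n)).
  by apply: measurable_wrt_sub (mxi t1); exact: Fle.
apply: measurable_funB; last exact: measurable_cst.
apply/(measurable_wrtE (sF n)).
have [mV _ _] := UV t1; apply: measurable_wrt_sub mV.
by apply: Fle; rewrite (leq_trans (leq_pred _)).
Qed.

(** Since E_{t-1}[exp xi_t] <= V_t <= exp (V_t - 1), the increment
    xi_t - (V_t - 1) has conditional exponential mean at most 1. *)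
Lemma integral_exp_supermartingale_le1 n : (\int[P]_w (expR (S n w))%:E <= 1)%E.
Proof.
have [sF Fm Fle] := hF.
elim: n => [|n IH].
  under eq_integral do rewrite /S big_geq// expR0.
  rewrite integral_cst// mul1e; exact: probability_le1.
apply: le_trans IH.
have mSn : measurable_fun [set: T] (S n).
  exact: (measurable_wrt_measurable (Fm n) (mS n)).
have [mV iV eqUV] := UV (ltn0Sn n).
have mVn := measurable_wrt_measurable (Fm n) mV.
pose H w := expR (S n w - (V n.+1 w - 1)).
(* V is nonnegative only almost surely; its positive part is a majorant that
   is nonnegative everywhere and still below exp (V - 1). *)
pose V' w := Num.max (V n.+1 w) 0.
have mV' : measurable_fun [set: T] V' by exact: measurable_maxr.
have mH : measurable_wrt (F n) H.
  apply/(measurable_wrtE (sF n)); apply: measurableT_comp => //.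
  by apply: measurable_funB; [|apply: measurable_funB => //];
    apply/(measurable_wrtE (sF n)).
have mHT := measurable_wrt_measurable (Fm n) mH.
have U0 w : 0 <= U n.+1 w by apply: le_trans (xiU w _); rewrite ?expR_ge0.
have V'0 w : 0 <= V' w by rewrite /V' le_max lexx orbT.
have mUn := mU (ltn0Sn n).
apply: (@le_trans _ _ (\int[P]_w (H w * U n.+1 w)%:E)%E).
  apply: ge0_le_integral => //.
  - apply/measurable_EFinP; apply: measurableT_comp => //.
    exact: (measurable_wrt_measurable (Fm n.+1) (mS n.+1)).
  - by apply/measurable_EFinP; exact: measurable_funM.
  - move=> w _; rewrite lee_fin /S big_nat_recr//= -/(S n w) addrCA addrC.
    by rewrite expRD ler_wpM2l ?expR_ge0// xiU.
apply: (@le_trans _ _ (\int[P]_w (H w * V' w)%:E)%E).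
  apply: (ge0_integral_pullout_le (sF n) (Fm n)) => //; last first.
    by move=> w; exact: expR_ge0.
  move=> A FA; rewrite -eqUV//; have mA := Fm _ _ FA.
  apply: le_integral => //.
  - exact: integrableS iV.
  - have : P.-integrable A (fun w => (EFin \o V n.+1)^\+ w)%E.
      by apply: integrable_funepos => //; exact: integrableS iV.
    by apply: eq_integrable => // w _; rewrite funeposE /V' /= EFin_max.
  - by move=> w _; rewrite lee_fin /V' le_max lexx.
apply: ge0_le_integral => //.
- by move=> w _; rewrite lee_fin mulr_ge0 ?expR_ge0.
- by apply/measurable_EFinP; exact: measurable_funM.
- by apply/measurable_EFinP; apply: measurableT_comp.
- move=> w _; rewrite lee_fin /H expRD -[leRHS]mulr1 -mulrA.
  rewrite ler_wpM2l ?expR_ge0//.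
  rewrite expRN ler_pdivrMl ?expR_gt0// mulr1 /V' ge_max expR_ge0 andbT.
  by apply: le_trans (expR_ge1Dx _); rewrite addrCA subrr addr0.
Qed.

Lemma prob_exp_supermartingale_ge_le n c : 0 < c ->
  measurable [set w | c <= expR (S n w)] /\
  (P [set w | c <= expR (S n w)]%R <= (c^-1)%:E)%E.
Proof.
move=> c0; have [_ Fm _] := hF.
have mSn : measurable_fun [set: T] (S n).
  exact: (measurable_wrt_measurable (Fm n) (mS n)).
have mE : measurable_fun [set: T] (fun w => expR (S n w)).
  exact: measurableT_comp.
have mA : measurable [set w | c <= expR (S n w)]%R.
  by rewrite -[X in measurable X]setTI; apply: measurable_fun_ler.
split=> //; rewrite -[leRHS]mule1 lee_pdivlMl//.
apply: le_trans (integral_exp_supermartingale_le1 n).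
rewrite -[X in P X]setIT -integral_indic// -ge0_integralZl_EFin//; last 2 first.
- by apply/measurable_EFinP; exact: measurable_indic.
- exact: ltW.
apply: ge0_le_integral => //.
- by move=> w _; rewrite mule_ge0 ?lee_fin// ltW.
- by apply/measurable_EFinP; apply: measurable_funM => //;
    exact: measurable_indic.
- exact/measurable_EFinP.
- move=> w _; rewrite -EFinM lee_fin indicE.
  by case: (boolP (w \in _)) => [/set_mem|]; rewrite ?mulr1 ?mulr0 ?expR_ge0.
Qed.

End Integral.
End ExpSupermartingale.

(** * Real inequalities *)

Section Analysis.
Context (R : realType).
Implicit Types x a v : R.

(** The left-hand side is (1 + x)^(-1/2), and the square of the inequality times
    1 + x is a polynomial one.  The exponent 1/2 doubles the deviation term of
    the final estimate, which is where 4 log n = 2 log (n^2) comes from. *)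
Lemma expR_Nhalf_ln_le x : `|x| <= 2^-1 ->
  expR (- (ln (1 + x) / 2)) <= 1 - x / 2 + x ^+ 2.
Proof.
rewrite ler_norml => /andP[x1 x2].
have x0 : 0 < 1 + x by lra.
have q0 : 0 <= 1 - x / 2 + x ^+ 2 by have := sqr_ge0 x; lra.
have y0 := expR_ge0 (- (ln (1 + x) / 2)).
rewrite -ler_sqr ?nnegrE// expr2 -expRD.
have -> : - (ln (1 + x) / 2) + - (ln (1 + x) / 2) = - ln (1 + x) by lra.
rewrite expRN lnK ?posrE// -div1r ler_pdivrMr//.
have -> : (1 - x / 2 + x ^+ 2) ^+ 2 * (1 + x) =
    1 + x ^+ 2 * (5%:R / 4%:R * (1 + x) + x * x ^+ 2) by field.
rewrite lerDl mulr_ge0 ?sqr_ge0//.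
have : x ^+ 2 <= 4^-1 by nra.
have := sqr_ge0 x; nra.
Qed.

(** Half of the maximizer a / (4 v) of the quadratic g a - 2 g^2 v, capped at
    1/2, already gives this rate; the cap is active when 4 v <= a. *)
Lemma exists_bet_growth a v : 0 <= a -> 0 <= v ->
  exists2 g, 0 <= g <= 2^-1 &
  a / 4 * (if v == 0 then 1 else Num.min 1 (a / (4 * v))) <=
  g * a - 2 * g ^+ 2 * v.
Proof.
move=> a0 v0; case: eqVneq => [->|vn0].
  by exists 2^-1; lra.
have {vn0}v0 : 0 < v by rewrite lt_def vn0.
have [av|va] := leP (4 * v) a.
  exists 2^-1; first lra.
  rewrite min_l; first nra.
  by rewrite ler_pdivlMr ?mul1r// mulr_gt0.
exists (a / (8 * v)).
  rewrite divr_ge0 ?mulr_ge0//=; last lra.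
  by rewrite ler_pdivrMr; lra.
rewrite min_r; last by rewrite ler_pdivrMr; lra.
rewrite -subr_ge0.
have -> : a / (8 * v) * a - 2 * (a / (8 * v)) ^+ 2 * v -
  a / 4 * (a / (4 * v)) = a ^+ 2 / (32 * v) by field; rewrite gt_eqF.
by rewrite divr_ge0 ?sqr_ge0// mulr_ge0// ltW.
Qed.

(** Telescoping 1/(n+1)^2 <= 1/n - 1/(n+1) from n = 1; with the convention
    1/0 = 0 the bound also holds for the empty sum. *)
Lemma sum_inv_square_le n :
  \sum_(1 <= k < n.+1) (k%:R ^+ 2)^-1 <= 2 - n%:R^-1 :> R.
Proof.
elim: n => [|n IH]; first by rewrite big_geq// invr0 subr0.
rewrite big_nat_recr//=; case: n IH => [_|n IH].
  by rewrite big_geq// expr1n invr1; lra.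
apply: le_trans (lerD IH (lexx _)) _.
have n0 : 0 < n.+1%:R :> R by [].
rewrite (_ : n.+2%:R = n.+1%:R + 1 :> R); last by rewrite -natr1.
move: n0; set m : R := n.+1%:R => m0; rewrite -subr_ge0.
have -> : 2 - (m + 1)^-1 - (2 - m^-1 + ((m + 1) ^+ 2)^-1) =
  (m * (m + 1) ^+ 2)^-1 by field; lra.
by rewrite invr_ge0 mulr_ge0 ?sqr_ge0// ltW.
Qed.

Lemma sin_le_id x : 0 <= x -> sin x <= x.
Proof.
move=> x0.
have [|c _] := @MVT_segment R sin cos 0 x x0 (fun y _ => is_derive_sin y).
  by apply: continuous_subspaceT; exact: continuous_sin.
by rewrite sin0 !subr0 => ->; rewrite ler_piMl// cos_le1.
Qed.

(** From sin (pi/4)^2 = 1/2 and sin (pi/4) <= pi/4. *)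
Lemma sqr_pi_ge8 : 8 <= pi ^+ 2 :> R.
Proof.
have p0 := @pi_gt0 R.
have sc : sin (pi / 4) = cos (pi / 4) :> R.
  have c0 : cos (pi / 4) != 0 :> R by rewrite gt_eqF// cos_gt0_pihalf//; lra.
  by rewrite -[LHS](divfK c0) -/(tan _) tan_piquarter mul1r.
have s2 : sin (pi / 4) ^+ 2 = 2^-1 :> R.
  by have := cos2Dsin2 (pi / 4 : R); rewrite -sc; lra.
have s0 : 0 <= sin (pi / 4) :> R by rewrite sin_ge0_pi//; lra.
have : sin (pi / 4) <= pi / 4 :> R by apply: sin_le_id; lra.
nra.
Qed.

Lemma nneseries_inv_square_le :
  (\sum_(1 <= n <oo) ((n%:R ^+ 2)^-1)%:E <= (pi ^+ 2 / 3 : R)%:E)%E.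
Proof.
apply: lime_le.
  by apply: is_cvg_nneseries => n _ _; rewrite lee_fin invr_ge0 sqr_ge0.
apply: nearW => -[|n].
  by rewrite big_geq// lee_fin; have := sqr_pi_ge8; lra.
rewrite sumEFin lee_fin; apply: le_trans (sum_inv_square_le n) _.
have n0 : 0 <= n%:R^-1 :> R by [].
by have := sqr_pi_ge8; lra.
Qed.

End Analysis.

(** * Euclidean geometry *)

Section Euclidean.
Context (R : realType) (d : nat).
Implicit Types x y h : 'cV[R]_d.

Lemma norm2_ge0 x : 0 <= norm2 x. Proof. exact: sqrtr_ge0. Qed.

Lemma norm2_sqr x : norm2 x ^+ 2 = dotv x x.
Proof.
rewrite /norm2 sqr_sqrtr; last by apply: sumr_ge0 => i _; exact: sqr_ge0.
by apply: eq_bigr => i _; rewrite expr2.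
Qed.

Lemma dotvC x y : dotv x y = dotv y x.
Proof. by apply: eq_bigr => i _; rewrite mulrC. Qed.

Lemma dotvZl c x y : dotv (c *: x) y = c * dotv x y.
Proof.
by rewrite /dotv mulr_sumr; apply: eq_bigr => i _; rewrite !mxE mulrA.
Qed.

Lemma dotv_sumr h (n : nat) (f : nat -> 'cV[R]_d) :
  dotv h (\sum_(1 <= t < n.+1) f t) = \sum_(1 <= t < n.+1) dotv h (f t).
Proof.
rewrite /dotv [RHS]exchange_big/=; apply: eq_bigr => i _.
by rewrite summxE mulr_sumr.
Qed.

Lemma norm2Z c x : 0 <= c -> norm2 (c *: x) = c * norm2 x.
Proof.
move=> c0; apply/eqP; rewrite -(@eqrXn2 _ 2)// ?mulr_ge0 ?norm2_ge0//.
by rewrite exprMn !norm2_sqr dotvZl dotvC dotvZl mulrA expr2.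
Qed.

Lemma norm2_eq0 x : norm2 x = 0 -> x = 0.
Proof.
move=> x0; have : \sum_i x i 0 ^+ 2 = 0.
  transitivity (dotv x x); last by rewrite -norm2_sqr x0 expr0n.
  by apply: eq_bigr => i _; rewrite expr2.
move=> /(psumr_eq0P (fun i _ => sqr_ge0 (x i 0))) h.
apply/matrixP => i j; rewrite ord1 mxE.
by apply/eqP; rewrite -sqrf_eq0; apply/eqP; exact: h.
Qed.

(** Cauchy-Schwarz, by expanding the nonnegative sum of the squares of the
    coordinates of |y| x - |x| y. *)
Lemma dotv_le_norm2M x y : dotv x y <= norm2 x * norm2 y.
Proof.
have [x0|xn0] := eqVneq (norm2 x) 0.
  rewrite x0 mul0r (norm2_eq0 x0) /dotv big1// => i _.
  by rewrite mxE mul0r.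
have [y0|yn0] := eqVneq (norm2 y) 0.
  rewrite y0 mulr0 (norm2_eq0 y0) /dotv big1// => i _.
  by rewrite mxE mulr0.
have xy0 : 0 < norm2 x * norm2 y.
  by rewrite mulr_gt0// lt_def norm2_ge0 ?xn0 ?yn0.
have : 0 <= \sum_i (norm2 y * x i 0 - norm2 x * y i 0) ^+ 2.
  by apply: sumr_ge0 => i _; exact: sqr_ge0.
have -> : \sum_i (norm2 y * x i 0 - norm2 x * y i 0) ^+ 2 =
  norm2 y ^+ 2 * dotv x x - 2 * (norm2 x * norm2 y) * dotv x y +
  norm2 x ^+ 2 * dotv y y.
  rewrite /dotv !mulr_sumr -sumrB -big_split/=; apply: eq_bigr => i _; ring.
rewrite -!norm2_sqr.
have -> : norm2 y ^+ 2 * norm2 x ^+ 2 - 2 * (norm2 x * norm2 y) * dotv x y +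
  norm2 x ^+ 2 * norm2 y ^+ 2 =
  2 * ((norm2 x * norm2 y) * (norm2 x * norm2 y - dotv x y)) by ring.
by rewrite pmulr_rge0// pmulr_rge0// subr_ge0.
Qed.

Lemma normr_dotv_le x y : `|dotv x y| <= norm2 x * norm2 y.
Proof.
rewrite ler_norml dotv_le_norm2M andbT lerNl -mulN1r -dotvZl.
apply: le_trans (dotv_le_norm2M _ _) _; rewrite ler_wpM2r ?norm2_ge0//.
rewrite -ler_sqr ?nnegrE ?norm2_ge0// !norm2_sqr dotvZl dotvC dotvZl.
by rewrite !mulN1r opprK.
Qed.

Lemma sup_dual_ball B x : 0 < B ->
  sup [set dotv h x | h in @dual_ball R d B] = norm2 x / B.
Proof.
move=> B0; have bound h : @dual_ball R d B h -> dotv h x <= norm2 x / B.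
  move=> hB; apply: le_trans (dotv_le_norm2M _ _) _.
  rewrite mulrC ler_wpM2l ?norm2_ge0//.
  by rewrite -div1r ler_pdivlMr// mulrC.
apply/eqP; rewrite eq_le; apply/andP; split.
  apply: ge_sup; last by move=> _ [h hB <-]; exact: bound.
  exists (dotv 0 x), 0 => //=.
  by rewrite /dual_ball/= -(scale0r 0) norm2Z// mul0r mulr0.
apply: ub_le_sup.
  exists (norm2 x / B) => _ [h hB <-]; exact: bound.
have [x0|xn0] := eqVneq (norm2 x) 0.
  exists 0; first by rewrite /dual_ball/= -(scale0r 0) norm2Z// mul0r mulr0.
  by rewrite x0 mul0r (norm2_eq0 x0) /dotv big1// => i _; rewrite mxE mul0r.
have x0 : 0 < norm2 x by rewrite lt_def xn0 norm2_ge0.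
have c0 : 0 <= (B * norm2 x)^-1 by rewrite invr_ge0 mulr_ge0// ltW.
exists ((B * norm2 x)^-1 *: x).
  by rewrite /dual_ball/= norm2Z// mulrCA mulVf// gt_eqF// mulr_gt0.
by rewrite dotvZl -norm2_sqr; field; rewrite xn0 gt_eqF.
Qed.

End Euclidean.

(** * Versions of conditional expectations *)

Section CondexpAlgebra.
Context (R : realType) (disp : measure_display) (T : measurableType disp).
Variables (P : probability T R) (G : set (set T)).
Hypotheses (sG : sigma_algebra [set: T] G) (GS : G `<=` measurable).
Implicit Types (Y Z : T -> R) (c : R).

Lemma is_condexp_cst c : is_condexp P G (fun=> c) (fun=> c).
Proof.
split=> //; last exact: finite_measure_integrable_cst.
by apply/(measurable_wrtE sG); exact: measurable_cst.
Qed.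

Lemma is_condexpZ c Y Z : P.-integrable [set: T] (EFin \o Y) ->
  is_condexp P G Y Z -> is_condexp P G (fun w => c * Y w) (fun w => c * Z w).
Proof.
move=> iY [mZ iZ YZ]; split.
- by apply/(measurable_wrtE sG); apply: measurable_funM;
    [exact: measurable_cst|exact/(measurable_wrtE sG)].
- by have := integrableZl measurableT c iZ; apply: eq_integrable.
- move=> A GA; have mA := GS GA; under eq_integral do rewrite EFinM.
  rewrite integralZl ?YZ//; last exact: integrableS iZ.
  under [RHS]eq_integral do rewrite EFinM.
  by rewrite integralZl//; exact: integrableS iY.
Qed.

Lemma is_condexpD Y1 Y2 Z1 Z2 :
  P.-integrable [set: T] (EFin \o Y1) -> P.-integrable [set: T] (EFin \o Y2) ->
  is_condexp P G Y1 Z1 -> is_condexp P G Y2 Z2 ->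
  is_condexp P G (fun w => Y1 w + Y2 w) (fun w => Z1 w + Z2 w).
Proof.
move=> iY1 iY2 [mZ1 iZ1 YZ1] [mZ2 iZ2 YZ2]; split.
- by apply/(measurable_wrtE sG); apply: measurable_funD;
    exact/(measurable_wrtE sG).
- by have := integrableD measurableT iZ1 iZ2; apply: eq_integrable.
- move=> A GA; have mA := GS GA; under eq_integral do rewrite EFinD.
  rewrite integralD ?YZ1 ?YZ2//;
    [|exact: integrableS iZ1|exact: integrableS iZ2].
  under [RHS]eq_integral do rewrite EFinD.
  by rewrite integralD//; [exact: integrableS iY1|exact: integrableS iY2].
Qed.

Lemma is_condexp0_ae Z :
  is_condexp P G (fun=> 0) Z -> {ae P, forall w, Z w = 0}.
Proof.
move=> [mZ iZ Z0]; have mZT := measurable_wrt_measurable GS mZ.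
have int0 A : G A -> (\int[P]_(w in A) (Z w)%:E)%E = 0.
  by move=> GA; rewrite Z0//; exact: integral0.
have : ae_eq P setT (EFin \o Z) (cst 0).
  apply/ae_eq_integral_abs => //; first exact/measurable_EFinP.
  (* The sign sets of Z belong to G, so the integrals of Z over them vanish. *)
  pose A := [set w | 0 <= Z w].
  have GA : G A.
    rewrite (_ : A = Z @^-1` `[0, +oo[%classic); first exact: mZ.
    by apply/seteqP; split=> w /=; rewrite in_itv/= andbT.
  have GAc : G (~` A) by rewrite -setTD; case: sG => _ + _; apply.
  have mA := GS GA; have mAc := GS GAc.
  rewrite -(setUv A) ge0_integral_setU//; last 2 first.
  - by rewrite setUv; apply: measurableT_comp => //; exact/measurable_EFinP.
  - by apply/disj_setPCl.
  rewrite -[RHS]adde0; congr (_ + _)%E.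
    rewrite -[RHS](int0 A)//; apply: eq_integral => w /set_mem Aw.
    by rewrite gee0_abs// lee_fin.
  rewrite (_ : 0 = (-1)%:E * \int[P]_(w in ~` A) (Z w)%:E)%E; last first.
    by rewrite int0// mule0.
  rewrite -integralZl//; last exact: integrableS iZ.
  apply: eq_integral => w /set_mem /= /negP; rewrite -ltNge => Aw.
  by rewrite ltr0_norm// -EFinM mulN1r.
by apply: filterS => w /(_ I)[].
Qed.

End CondexpAlgebra.

(** * Wealth and regret along a path *)

Section Regret.
Context (R : realType) (T : Type) (d : nat).
Variables (X eta : nat -> T -> 'cV[R]_d).
Implicit Types (gamma : nat -> T -> R) (g : R) (w : T).

Hypothesis bet_le1 : forall t w, (1 <= t)%N -> `|dotv (eta t w) (X t w)| <= 1.

Lemma bet_bounds t w g : (1 <= t)%N -> - 2^-1 <= g <= 2^-1 ->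
  2^-1 <= 1 + g * dotv (eta t w) (X t w) <= 2.
Proof.
move=> t1 g1; have : `|g * dotv (eta t w) (X t w)| <= 2^-1.
  rewrite normrM -[leRHS]mulr1; apply: ler_pM => //; last exact: bet_le1.
  by rewrite ler_norml.
by rewrite ler_norml => /andP[? ?]; lra.
Qed.

Lemma wealth_gt0 gamma n w :
  (forall t, (1 <= t)%N -> - 2^-1 <= gamma t w <= 2^-1) ->
  0 < wealth X eta gamma n w.
Proof.
move=> hg; rewrite /wealth big_nat_cond; apply: prodr_gt0 => t.
by rewrite andbT => /andP[t1 _]; have := bet_bounds w t1 (hg _ t1); lra.
Qed.

Lemma ln_wealth gamma n w :
  (forall t, (1 <= t)%N -> - 2^-1 <= gamma t w <= 2^-1) ->
  ln (wealth X eta gamma n w) =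
  \sum_(1 <= t < n.+1) ln (1 + gamma t w * dotv (eta t w) (X t w)).
Proof.
move=> hg; rewrite -[RHS]expRK expR_sum /wealth; congr (ln _).
apply: eq_big_nat => t /andP[t1 _]; rewrite lnK// posrE.
by have := bet_bounds w t1 (hg _ t1); lra.
Qed.

Lemma const_wealth_gt0 g n w : - 2^-1 <= g <= 2^-1 ->
  0 < const_wealth X eta g n w.
Proof. by move=> g1; exact: wealth_gt0. Qed.

Lemma has_sup_ln_const_wealth n w :
  has_sup [set ln (const_wealth X eta g n w) | g in `[- 2^-1, 2^-1]%classic].
Proof.
split.
  by exists (ln (const_wealth X eta 0 n w)), 0 => //=; rewrite in_itv/=; lra.
exists (ln (2 ^+ n)) => _ [g + <-]; rewrite /= in_itv/= => g1.
rewrite ler_ln ?posrE ?const_wealth_gt0 ?exprn_gt0//.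
rewrite /const_wealth /wealth.
rewrite -[X in _ <= 2 ^+ X]subn0 -(subSS 0) -prodr_const_nat.
rewrite big_nat_cond [leRHS]big_nat_cond; apply: ler_prod => t.
by rewrite andbT => /andP[t1 _]; have := bet_bounds w t1 g1; lra.
Qed.

Lemma ln_const_wealth_le gamma g n w : - 2^-1 <= g <= 2^-1 ->
  ln (const_wealth X eta g n w) - regret X eta gamma n w <=
  ln (wealth X eta gamma n w).
Proof.
move=> g1; rewrite /regret lerBlDr addrCA subrr addr0.
apply: ub_le_sup; first by have [] := has_sup_ln_const_wealth n w.
by exists g.
Qed.

Lemma continuous_const_wealth n w :
  continuous (fun g => const_wealth X eta g n w).
Proof.
rewrite /const_wealth /wealth; elim: n => [|n IH].
  by under eq_fun do rewrite big_geq//; move=> x; exact: cvg_cst.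
under eq_fun do rewrite big_nat_recr//=; move=> x; apply: cvgM; first exact: IH.
apply: cvgD; first exact: cvg_cst.
by apply: cvgM; [exact: cvg_id|exact: cvg_cst].
Qed.

(** Measurability of the regret: the supremum over bets is compared with c along
    countably many of them.  The bets are parametrized as sin x / 2 with x real,
    a continuous map onto [-1/2, 1/2], so that density of the rationals in the
    whole line applies and the endpoints need no separate treatment. *)
Lemma lt_regretE gamma n w (c : R) :
  (forall t, (1 <= t)%N -> - 2^-1 <= gamma t w <= 2^-1) ->
  c < regret X eta gamma n w <->
  exists q : rat, expR c * wealth X eta gamma n w <
    const_wealth X eta (sin (ratr q : R) / 2) n w.
Proof.
move=> hg; have W0 := wealth_gt0 n hg.
have ltE g : - 2^-1 <= g <= 2^-1 ->
    (c + ln (wealth X eta gamma n w) < ln (const_wealth X eta g n w)) =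
    (expR c * wealth X eta gamma n w < const_wealth X eta g n w).
  move=> g1; rewrite -[c in LHS]expRK -lnM ?posrE ?expR_gt0//.
  by rewrite ltr_ln// posrE ?mulr_gt0 ?expR_gt0// const_wealth_gt0.
have sinb (x : R) : - 2^-1 <= sin x / 2 <= 2^-1.
  by have := sin_le1 x; have := sin_geN1 x; lra.
split.
  rewrite /regret ltrBrDr => /sup_gt[|_ [g /= g1 <-]].
    by have [] := has_sup_ln_const_wealth n w.
  move: g1; rewrite in_itv/= => g1; rewrite ltE// => cg.
  pose f (x : R) := const_wealth X eta (sin x / 2) n w.
  have cf : continuous f.
    move=> x; rewrite /f; apply: (@continuous_comp _ _ _ (fun x => sin x / 2)
      (fun g => const_wealth X eta g n w)); last exact: continuous_const_wealth.
    by apply: cvgM; [exact: continuous_sin|exact: cvg_cst].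
  have [||x [/= cx [q _ qx]]] := @dense_rat R
      (f @^-1` [set y | expR c * wealth X eta gamma n w < y]).
  - exists (asin (2 * g)) => /=.
    rewrite /f asinK; last by rewrite in_itv/=; lra.
    by rewrite [2 * g]mulrC mulfK.
  - by apply: open_comp; [move=> x _; exact: cf|exact: open_gt].
  - by exists q; rewrite -qx in cx.
move=> [q]; rewrite -ltE// => cq.
rewrite /regret ltrBrDr; apply: lt_le_trans cq _.
apply: ub_le_sup; first by have [] := has_sup_ln_const_wealth n w.
by exists (sin (ratr q : R) / 2) => //=; rewrite in_itv/=.
Qed.

End Regret.

(** * Growth of the wealth at a fixed time *)

Section Growth.
Context (R : realType) (disp : measure_display) (T : measurableType disp).
Variables (P : probability T R) (F : nat -> set (set T)) (hF : filtration F).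
Variables (d : nat) (X eta EX : nat -> T -> 'cV[R]_d).
Variables (gamma EX2 EetaX : nat -> T -> R) (B : R).
Hypothesis hX : forall t, measurable_vec_wrt (F t) (X t).
Hypothesis XB : forall t w, norm2 (X t w) <= B.
Hypothesis B1 : B <= 1.
Hypothesis hgamma : forall n, (1 <= n)%N -> measurable_wrt (F n.-1) (gamma n).
Hypothesis gamma2 : forall n w, (1 <= n)%N -> - 2^-1 <= gamma n w <= 2^-1.
Hypothesis heta : forall n, (1 <= n)%N -> measurable_vec_wrt (F n.-1) (eta n).
Hypothesis etaB : forall n w, (1 <= n)%N -> dual_ball B (eta n w).
Hypothesis hEX : forall t, (1 <= t)%N -> is_condexp_vec P (F t.-1) (X t) (EX t).
Hypothesis hEX2 : forall t, (1 <= t)%N ->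
  is_condexp P (F t.-1) (fun w => norm2 (X t w) ^+ 2) (EX2 t).
Hypothesis hEetaX : forall t, (1 <= t)%N ->
  is_condexp P (F t.-1) (fun w => dotv (eta t w) (X t w)) (EetaX t).

Let Z t w := dotv (eta t w) (X t w).

Let sF n : sigma_algebra [set: T] (F n). Proof. by case: hF. Qed.
Let Fm n : F n `<=` measurable. Proof. by case: hF. Qed.
Let Fle n k : (n <= k)%N -> F n `<=` F k.
Proof. by case: hF => _ _; apply. Qed.

Let measurable_wrt_dotv n (f h : T -> 'cV[R]_d) :
  measurable_vec_wrt (F n) f -> measurable_vec_wrt (F n) h ->
  measurable_wrt (F n) (fun w => dotv (f w) (h w)).
Proof.
move=> mf mh; apply/(measurable_wrtE (sF n)); apply: measurable_sum => i.
by apply: measurable_funM; exact/(measurable_wrtE (sF n)).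
Qed.

Let B_ge0 (w : T) : 0 <= B.
Proof. exact: le_trans (norm2_ge0 _) (XB 0 w). Qed.

Let scaled_bet_le t w : (1 <= t)%N -> B * `|Z t w| <= norm2 (X t w).
Proof.
move=> t1; have Bw := B_ge0 w.
have := normr_dotv_le (eta t w) (X t w); rewrite -/(Z t w) => ZX.
apply: le_trans (ler_wpM2l Bw ZX) _; rewrite mulrA ler_piMl ?norm2_ge0//.
exact: etaB.
Qed.

Lemma normr_bet_le1 t w : (1 <= t)%N -> `|Z t w| <= 1.
Proof.
move=> t1; apply: le_trans (normr_dotv_le _ _) _.
apply: le_trans (etaB w t1); rewrite mulrC ler_wpM2r ?norm2_ge0//.
Qed.

Let mZ t : (1 <= t)%N -> measurable_wrt (F t) (Z t).
Proof.
move=> t1; apply: measurable_wrt_dotv => // i.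
by apply: measurable_wrt_sub (heta t1 i); apply: Fle; exact: leq_pred.
Qed.

Let msqX t : measurable_wrt (F t) (fun w => norm2 (X t w) ^+ 2).
Proof.
rewrite (_ : (fun _ => _) = fun w => dotv (X t w) (X t w)).
  exact: measurable_wrt_dotv.
by apply/funext => w; rewrite norm2_sqr.
Qed.

Let integrable_bounded (f : T -> R) c : measurable_fun [set: T] f ->
  (forall w, `|f w| <= c) -> P.-integrable [set: T] (EFin \o f).
Proof.
move=> mf fc; apply: measurable_bounded_integrable => //.
  by rewrite (le_lt_trans (probability_le1 _ _))// ltry.
exists c; split; first exact: num_real.
by move=> x cx w _; apply: le_trans (fc w) (ltW cx).
Qed.

Section FixedBet.
Variables (g : R).
Hypothesis g2 : 0 <= g <= 2^-1.

(** The exponential of the deficit is the inverse square root of the wealth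
    factor of the bet g B at time t; [quad_bound] dominates it and has
    [quad_condexp] as conditional expectation. *)
Definition log_deficit t w := - (ln (1 + g * B * Z t w) / 2).
Definition quad_bound t w :=
  1 + (- (g * B / 2) * Z t w + g ^+ 2 * norm2 (X t w) ^+ 2).
Definition quad_condexp t w :=
  1 + (- (g * B / 2) * EetaX t w + g ^+ 2 * EX2 t w).

Let expR_log_deficit_le t w : (1 <= t)%N ->
  expR (log_deficit t w) <= quad_bound t w.
Proof.
move=> t1; have Bw := B_ge0 w; have /andP[g0 g12] := g2.
have BZ := scaled_bet_le w t1.
have BZ2 : `|g * B * Z t w| <= g * norm2 (X t w).
  by rewrite -mulrA normrM ger0_norm// ler_wpM2l// normrM (ger0_norm Bw).
have x2 : `|g * B * Z t w| <= 2^-1.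
  apply: le_trans BZ2 _.
  by have := XB t w; have := B1; have := norm2_ge0 (X t w); nra.
apply: le_trans (expR_Nhalf_ln_le x2) _.
rewrite /quad_bound -!addrA lerD2l; apply: lerD; first by lra.
rewrite -(real_normK (num_real (g * B * Z t w))) -exprMn.
by rewrite ler_sqr ?nnegrE// ?mulr_ge0// norm2_ge0.
Qed.

Lemma prob_fixed_bet_deviation n c : 0 < c ->
  let A := [set w | c <= expR (\sum_(1 <= t < n.+1)
    (log_deficit t w - (quad_condexp t w - 1)))] in
  measurable A /\ (P A <= (c^-1)%:E)%E.
Proof.
move=> c0; apply: (@prob_exp_supermartingale_ge_le _ _ _ _ _ hF
  log_deficit quad_bound quad_condexp) => //.
- move=> t t1; apply/(measurable_wrtE (sF t)); apply: measurableT_comp => //.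
  apply: measurable_funM => //; apply: measurableT_comp => //.
  apply: measurable_funD => //; apply: measurable_funM => //.
  exact/(measurable_wrtE (sF t))/mZ.
- move=> t t1; apply: measurable_funD => //; apply: measurable_funD.
    apply: measurable_funM => //.
    exact: (measurable_wrt_measurable (@Fm t) (mZ t1)).
  apply: measurable_funM => //.
  exact: (measurable_wrt_measurable (@Fm t) (msqX t)).
- move=> t t1; have sG := sF t.-1; have sm := @Fm t.-1.
  have mZt := measurable_wrt_measurable (@Fm t) (mZ t1).
  have mXt := measurable_wrt_measurable (@Fm t) (msqX t).
  have iZ : P.-integrable setT (EFin \o Z t).
    by apply: (@integrable_bounded _ 1) => // w; exact: normr_bet_le1.
  have iX : P.-integrable setT (EFin \o (fun w => norm2 (X t w) ^+ 2)).
    apply: (@integrable_bounded _ 1) => // w.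
    rewrite ger0_norm ?sqr_ge0// expr_le1// ?norm2_ge0//.
    exact: le_trans (XB t w) B1.
  have i1 : P.-integrable setT (EFin \o (fun=> 1)).
    exact: finite_measure_integrable_cst.
  have iZl c' f : P.-integrable setT (EFin \o f) ->
      P.-integrable setT (EFin \o (fun w => c' * f w : R)).
    by move=> /(integrableZl measurableT c'); exact: eq_integrable.
  apply: is_condexpD => //; last 2 first.
  - exact: is_condexp_cst.
  - apply: is_condexpD => //; [exact: iZl|exact: iZl| |].
      exact: (is_condexpZ sG sm _ iZ (hEetaX t1)).
    exact: (is_condexpZ sG sm _ iX (hEX2 t1)).
  - have := integrableD measurableT
      (iZl (- (g * B / 2)) _ iZ) (iZl (g ^+ 2) _ iX).
    exact: eq_integrable.
Qed.

End FixedBet.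

Lemma sum_log_deficit g n w : 0 <= g <= 2^-1 ->
  \sum_(1 <= t < n.+1) (log_deficit g t w - (quad_condexp g t w - 1)) =
  - (ln (const_wealth X eta (g * B) n w) / 2)
  + (g * B / 2 * \sum_(1 <= t < n.+1) EetaX t w
     - g ^+ 2 * \sum_(1 <= t < n.+1) EX2 t w).
Proof.
move=> g2; have Bw := B_ge0 w.
rewrite [const_wealth _ _ _ _ _]/const_wealth ln_wealth; last 2 first.
- by move=> t ? ?; exact: normr_bet_le1.
- by move=> t _; have := B1; nra.
rewrite mulr_suml -sumrN !mulr_sumr -sumrB -big_split/=.
apply: eq_bigr => t _; rewrite /log_deficit /quad_condexp /Z; ring.
Qed.

Section DeterministicGrowth.
Variables (r s m v : nat -> R) (n : nat).
Hypothesis n1 : (1 <= n)%N.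
Hypothesis s0 : 0 <= s n.

(** The pathwise part of the argument: outside the four exceptional events the
    bet g B already achieves the growth rate.  The condition that g vanishes
    when n m_n <= s_n lets the drift be replaced by its positive part. *)
Lemma log_growth_le_ln_wealth g w :
  0 < B -> 0 <= g <= 2^-1 ->
  (let a := Num.max (n%:R * m n - s n) 0 in
   a / 4 * (if v n == 0 then 1 else Num.min 1 (a / (4 * n%:R * v n))) <=
   g * a - 2 * g ^+ 2 * (n%:R * v n)) ->
  (n%:R * m n - s n <= 0 -> g = 0) ->
  regret X eta gamma n w <= r n ->
  stoch_regret EX EetaX B n w <= s n ->
  m n <= mean_norm EX n w -> mean_sq EX2 n w <= v n ->
  expR (\sum_(1 <= t < n.+1) (log_deficit g t w - (quad_condexp g t w - 1)))
    < n%:R ^+ 2 ->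
  log_growth r s m v n <= ln (wealth X eta gamma n w).
Proof.
move=> B0 g2 ga ga0 hr hs hm hv; rewrite sum_log_deficit// => hE.
have np : 0 < n%:R :> R by rewrite ltr0n.
have gB2 : - 2^-1 <= g * B <= 2^-1 by have := B1; nra.
have WL := @ln_const_wealth_le R T d X eta (fun t w t1 => normr_bet_le1 w t1)
  gamma (g * B) n w gB2.
set L := ln (const_wealth X eta (g * B) n w) in hE WL.
have {}hE : - (L / 2) + (g * B / 2 * \sum_(1 <= t < n.+1) EetaX t w
     - g ^+ 2 * \sum_(1 <= t < n.+1) EX2 t w) < 2 * ln n%:R.
  rewrite -ltr_expR (_ : 2 * ln n%:R = ln (n%:R ^+ 2)).
    by rewrite lnK ?posrE ?exprn_gt0.
  by rewrite lnXn// mulr_natl.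
have {}hv : \sum_(1 <= t < n.+1) EX2 t w <= n%:R * v n.
  by move: hv; rewrite /mean_sq mulrC -ler_pdivlMr ?invr_gt0// invrK mulrC.
have {}hm : n%:R * m n <= norm2 (\sum_(1 <= t < n.+1) EX t w).
  by move: hm; rewrite /mean_norm norm2Z ?invr_ge0// mulrC ler_pdivlMr// mulrC.
have {}hs : norm2 (\sum_(1 <= t < n.+1) EX t w) / B - s n <=
    \sum_(1 <= t < n.+1) EetaX t w.
  move: hs; rewrite /stoch_regret -sup_dual_ball// lerBlDr addrC -lerBlDr.
  by under eq_imagel do rewrite -dotv_sumr.
(* The bet is scaled by B, which turns the drift n m_n / B - s_n into
   n m_n - B s_n >= n m_n - s_n. *)
have drift : g * (n%:R * m n - s n) <= g * B * \sum_(1 <= t < n.+1) EetaX t w.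
  rewrite -mulrA ler_wpM2l//; first lra.
  have : B * (norm2 (\sum_(1 <= t < n.+1) EX t w) / B - s n) <=
    B * \sum_(1 <= t < n.+1) EetaX t w by rewrite ler_wpM2l// ltW.
  rewrite mulrBr mulrCA divff ?gt_eqF// mulr1.
  have : B * s n <= s n by rewrite ler_piMl.
  lra.
have gaE : g * Num.max (n%:R * m n - s n) 0 = g * (n%:R * m n - s n).
  by case: leP => // /ga0 ->; rewrite !mul0r.
have gv : 2 * g ^+ 2 * \sum_(1 <= t < n.+1) EX2 t w <=
    2 * g ^+ 2 * (n%:R * v n).
  by rewrite ler_wpM2l// mulr_ge0// sqr_ge0.
move: ga; rewrite /log_growth /= gaE.
set lhs := _ * (if _ then _ else _); lra.
Qed.

End DeterministicGrowth.
Let W := wealth X eta gamma.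

Let mP (f : T -> R) n : measurable_wrt (F n) f -> measurable_fun [set: T] f.
Proof. by move=> mf; exact: (measurable_wrt_measurable (@Fm n) mf). Qed.

Let measurable_set_ltr (f h : T -> R) :
  measurable_fun [set: T] f -> measurable_fun [set: T] h ->
  measurable [set w | f w < h w].
Proof.
move=> mf mh; rewrite -[X in measurable X]setTI.
by have := measurable_fun_ltr mf mh; move=> /(_ measurableT [set true]); apply.
Qed.

Lemma measurable_wealth (b : nat -> T -> R) n :
  (forall t, (1 <= t)%N -> measurable_fun [set: T] (b t)) ->
  measurable_fun [set: T] (wealth X eta b n).
Proof.
move=> mb; apply: measurable_prod => t; rewrite mem_index_iota => /andP[t1 _].
apply: measurable_funD => //; apply: measurable_funM; first exact: mb.
exact: mP (mZ t1).
Qed.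

Let mW n : measurable_fun [set: T] (W n).
Proof. by apply: measurable_wealth => t t1; exact: mP (hgamma t1). Qed.

Lemma measurable_ln_wealth_lt n c : measurable [set w | ln (W n w) < c].
Proof. by apply: measurable_set_ltr => //; exact: measurableT_comp. Qed.

Lemma measurable_regret_gt n c :
  measurable [set w | c < regret X eta gamma n w].
Proof.
rewrite (_ : [set w | _] = \bigcup_(q : rat) [set w | expR c * W n w <
    const_wealth X eta (sin (ratr q : R) / 2) n w]).
  apply: bigcupT_measurable_rat => q; apply: measurable_set_ltr.
    exact: measurable_funM.
  by apply: measurable_wealth => t _; exact: measurable_cst.
have hE w := @lt_regretE R T d X eta (fun t w t1 => normr_bet_le1 w t1)
  gamma n w c (fun t => @gamma2 t w).
apply/seteqP; split=> w /=; first by move=> /hE[q cq]; exists q.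
by move=> [q _ cq]; apply/hE; exists q.
Qed.

Let measurable_norm2 (f : T -> 'cV[R]_d) :
  (forall i, measurable_fun [set: T] (fun w => f w i 0)) ->
  measurable_fun [set: T] (fun w => norm2 (f w)).
Proof.
move=> mf; rewrite /norm2.
apply: (@measurableT_comp _ _ _ _ _ _ (@Num.sqrt R)
  _ (fun w => \sum_(i < d) f w i 0 ^+ 2)).
  by apply: continuous_measurable_fun; exact: sqrt_continuous.
by apply: measurable_sum => i; exact: measurable_funX.
Qed.

Let measurable_sum_condexp (Y V : nat -> T -> R) n :
  (forall t, (1 <= t)%N -> is_condexp P (F t.-1) (Y t) (V t)) ->
  measurable_fun [set: T] (fun w => \sum_(1 <= t < n.+1) V t w).
Proof.
move=> YV; apply: (@mP _ n); apply: measurable_wrt_sum => // t /andP[t1 tn].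
have [mV _ _] := YV _ t1; apply: measurable_wrt_sub mV.
by apply: Fle; exact: leq_trans (leq_pred _) tn.
Qed.

Let measurable_sum_EX n i :
  measurable_fun [set: T] (fun w => (\sum_(1 <= t < n.+1) EX t w) i 0).
Proof.
under eq_fun do rewrite summxE.
by apply: (@measurable_sum_condexp (fun t w => X t w i 0)) => t t1; exact: hEX.
Qed.

Lemma measurable_mean_norm n : measurable_fun [set: T] (mean_norm EX n).
Proof.
apply: measurable_norm2 => i; under eq_fun do rewrite mxE.
by apply: measurable_funM => //; exact: measurable_cst.
Qed.

Lemma measurable_moment_event n a b :
  measurable [set w | (mean_norm EX n w < a)%R \/ (b < mean_sq EX2 n w)%R].
Proof.
apply: measurableU; apply: measurable_set_ltr => //.
  exact: measurable_mean_norm.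
apply: measurable_funM => //.
exact: (measurable_sum_condexp _ hEX2).
Qed.

Lemma measurable_stoch_regret_gt n c : 0 < B ->
  measurable [set w | c < stoch_regret EX EetaX B n w].
Proof.
move=> B0; apply: measurable_set_ltr => //; rewrite /stoch_regret.
apply: measurable_funB; last exact: (measurable_sum_condexp _ hEetaX).
rewrite (_ : (fun w => _) = fun w => norm2 (\sum_(1 <= t < n.+1) EX t w) / B).
  by apply: measurable_funM => //; exact: measurable_norm2.
apply/funext => w; rewrite -sup_dual_ball//.
by under eq_imagel do rewrite -dotv_sumr.
Qed.

Section OneStep.
Variables (r s m v : nat -> R) (n : nat).
Hypothesis n1 : (1 <= n)%N.
Hypotheses (r0 : 0 <= r n) (s0 : 0 <= s n) (m0 : 0 <= m n) (v0 : 0 <= v n).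

Let slow := [set w | (ln (W n w) < log_growth r s m v n)%R].
Let evR := [set w | (r n < regret X eta gamma n w)%R].
Let evS := [set w | (s n < stoch_regret EX EetaX B n w)%R].
Let evV := [set w | (mean_norm EX n w < m n)%R \/ (v n < mean_sq EX2 n w)%R].

Let np : 0 < n%:R :> R. Proof. by rewrite ltr0n. Qed.

Let exists_fixed_bet : exists2 g, 0 <= g <= 2^-1 &
  (let a := Num.max (n%:R * m n - s n) 0 in
   a / 4 * (if v n == 0 then 1 else Num.min 1 (a / (4 * n%:R * v n))) <=
   g * a - 2 * g ^+ 2 * (n%:R * v n)) /\ (n%:R * m n - s n <= 0 -> g = 0).
Proof.
have [a0|a0] := leP (n%:R * m n - s n) 0.
  exists 0; first lra.
  by split=> //=; rewrite !mul0r expr0n/= mulr0 mul0r subr0.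
have [||g g2 ga] := @exists_bet_growth R (n%:R * m n - s n) (n%:R * v n).
- exact: ltW.
- by rewrite mulr_ge0// ltW.
exists g => //; split=> //=.
by move: ga; rewrite mulf_eq0 gt_eqF//= mulrA.
Qed.

Let prob_slow_le_pos : 0 < B ->
  (P slow <= P evR + P evV + P evS + ((n%:R ^+ 2)^-1)%:E)%E.
Proof.
move=> B0; have [g g2 [ga ga0]] := exists_fixed_bet.
have n20 : 0 < n%:R ^+ 2 :> R by rewrite exprn_gt0.
pose evM := [set w | n%:R ^+ 2 <= expR (\sum_(1 <= t < n.+1)
    (log_deficit g t w - (quad_condexp g t w - 1)))].
have mR : measurable evR by exact: measurable_regret_gt.
have mS : measurable evS by exact: measurable_stoch_regret_gt.
have mV : measurable evV by exact: measurable_moment_event.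
have [mM PM] : measurable evM /\ (P evM <= ((n%:R ^+ 2)^-1)%:E)%E.
  exact: (prob_fixed_bet_deviation g2 n n20).
have sub : slow `<=` evR `|` evV `|` evS `|` evM.
  move=> w; apply: contraPP; rewrite /= !not_orP.
  move=> [[[/negP nR [/negP nm /negP nv]] /negP nS] /negP nM].
  rewrite -!leNgt in nR nm nv nS; rewrite -ltNge in nM.
  apply/negP; rewrite -leNgt.
  exact: (log_growth_le_ln_wealth n1 s0 B0 g2 ga ga0 nR nS nm nv nM).
apply: (@le_trans _ _ (P (evR `|` evV `|` evS `|` evM))).
  apply: le_measure; rewrite ?inE//; first exact: measurable_ln_wealth_lt.
  by do 3 apply: measurableU => //.
apply: le_trans (measureU2 _ _ _) _ => //.
  by do 2 apply: measurableU => //.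
apply: leeD PM.
apply: le_trans (measureU2 _ _ _) _ => //; first by apply: measurableU.
by rewrite leeD2r//; exact: measureU2.
Qed.

(* Here X = 0 and W_n = 1.  Either m_n = 0, and then u_n <= 0, or the moment
   event has probability 1 because mu_n = 0 almost surely. *)
Let prob_slow_le_zero : B <= 0 -> (P slow <= P evV)%E.
Proof.
move=> B0.
have X0 t w : X t w = 0.
  apply: norm2_eq0; apply/eqP.
  by rewrite eq_le norm2_ge0 (le_trans (XB t w) B0).
have lnW0 w : ln (W n w) = 0.
  rewrite /W /wealth big1 ?ln1// => t _.
  by rewrite X0 /dotv big1 ?mulr0 ?addr0// => i _; rewrite mxE mulr0.
have [mn0|mn0] := leP (m n) 0.
  rewrite (_ : slow = set0) ?measure0//; apply/seteqP; split=> // w.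
  rewrite /slow/= lnW0 ltNge => /negP; apply.
  have -> : log_growth r s m v n = - (4 * ln n%:R) - r n.
    rewrite /log_growth/= max_r; first by rewrite !mul0r sub0r.
    have -> : m n = 0 by apply/eqP; rewrite eq_le mn0 m0.
    by rewrite mulr0 sub0r oppr_le0.
  have : 0 <= ln n%:R :> R by rewrite ln_ge0// ler1n.
  by have := r0; lra.
have mV : measurable evV by exact: measurable_moment_event.
have EX0 : {ae P, forall w, forall t : nat, forall i,
    (1 <= t)%N -> EX t w i 0 = 0}.
  apply: ae_foralln => t; apply: filter_forall => i.
  have [t1|] := leqP 1 t; last by rewrite ltnS leqn0 => /eqP ->; exact: nearW.
  have := hEX t1 i; rewrite (_ : (fun w => X t w i 0) = fun=> 0).
    by move=> c0; apply: filterS (is_condexp0_ae (sF t.-1) (@Fm t.-1) c0).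
  by apply/funext => w; rewrite X0 mxE.
have PV0 : P (~` evV) = 0%E.
  apply/negligibleP; first exact: measurableC.
  apply: negligibleS EX0 => w /=; apply: contra_not => EXw; left.
  rewrite /mean_norm (_ : \sum_(1 <= t < n.+1) EX t w = 0).
    by rewrite scaler0 (_ : norm2 0 = 0)// -(scale0r 0) norm2Z// mul0r.
  rewrite big_nat_cond big1// => t /andP[/andP[t1 _] _].
  by apply/matrixP => i j; rewrite ord1 mxE EXw.
have -> : P evV = 1%E.
  by rewrite -[evV]setCK probability_setC ?PV0 ?sube0//; exact: measurableC.
by apply: probability_le1; exact: measurable_ln_wealth_lt.
Qed.

Lemma prob_ln_wealth_lt_le :
  (P slow <= P evR + P evV + P evS + ((n%:R ^+ 2)^-1)%:E)%E.
Proof.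
have [B0|B0] := ltP 0 B; first exact: prob_slow_le_pos.
apply: le_trans (prob_slow_le_zero B0) _.
rewrite -[leLHS]adde0; apply: leeD; last by rewrite lee_fin invr_ge0 sqr_ge0.
rewrite -[leLHS]adde0; apply: leeD => //.
by rewrite -[leLHS]add0e; exact: leeD.
Qed.

End OneStep.
End Growth.

(** * Summation over time *)

Section Series.
Context (R : realType).
Local Open Scope ereal_scope.
Implicit Types f g : nat -> \bar R.

(** Moving the index condition into the summand lets termwise estimates that
    are known for n >= 1 only be applied at every index. *)
Lemma nneseries1E f :
  \sum_(1 <= n <oo) f n = \sum_(n <oo) (if (1 <= n)%N then f n else 0).
Proof.
rewrite -eseries_mkcond; congr (limn _); apply/funext => k.
by rewrite (big_nat_widenl 1 0).
Qed.

Lemma lee_nneseries1 f g : (forall n, (1 <= n)%N -> 0 <= f n) ->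
  (forall n, (1 <= n)%N -> f n <= g n) ->
  \sum_(1 <= n <oo) f n <= \sum_(1 <= n <oo) g n.
Proof.
move=> f0 fg; rewrite !nneseries1E; apply: lee_nneseries => n _.
  by case: ifPn => // n1 _; exact: f0.
by case: ifPn => // n1; exact: fg.
Qed.

End Series.

Section Events.
Context (R : realType) (disp : measure_display) (T : measurableType disp).
Variable P : probability T R.

Lemma ae_eventually_not (A : (set T)^nat) : (forall n, measurable (A n)) ->
  (\sum_(n <oo) P (A n) < +oo)%E ->
  {ae P, forall w, \forall n \near \oo, ~ A n w}.
Proof.
move=> mA fin; have mL : measurable (lim_sup_set A).
  by apply: bigcapT_measurable => n; apply: bigcup_measurable.
have /(negligibleP P mL)[N [mN N0 sub]] := lim_sup_set_cvg0 mA fin.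
exists N; split=> //; apply: subset_trans sub => w /= h n _.
apply: contrapT => nA; apply: h; exists n => // k /= nk Ak.
by apply: nA; exists k.
Qed.

Lemma limn_einf_ge1 (f : nat -> R) :
  (\forall n \near \oo, 1 <= f n) -> (1 <= limn_einf (fun n => (f n)%:E))%E.
Proof.
case=> N _ hN; rewrite limn_einf_lim.
apply: lime_ge; first exact: is_cvg_einfs.
exists N => // n /= Nn; apply: le_ereal_inf_tmp => _ [k /= nk <-].
by rewrite lee_fin; apply: hN => /=; exact: leq_trans nk.
Qed.

(** The integral of a nonnegative function is a supremum over the simple
    functions below it, so it is monotone on arbitrary functions; this is
    applied to the stopping time. *)
Lemma ge0_integral_mono (f g : T -> \bar R) : (forall w, 0 <= f w)%E ->
  (forall w, f w <= g w)%E -> (\int[P]_w f w <= \int[P]_w g w)%E.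
Proof.
move=> f0 fg; have g0 w : (0 <= g w)%E by exact: le_trans (f0 w) (fg w).
rewrite !ge0_integralTE//; apply: ereal_sup_le => _ [h hf <-].
by exists h => // w; exact: le_trans (hf w) (fg w).
Qed.

(** The first time k >= N outside the sets A_n is a time at which W has reached
    1/alpha, and all the times in [N, k) are in these sets; hence the stopping
    time is at most N plus the number of n such that A_n occurs. *)
Lemma integral_stopping_le (A : (set T)^nat) (W : nat -> T -> R) alpha N :
  (forall n, measurable (A n)) ->
  (forall n w, (N <= n)%N -> ~ A n w -> alpha^-1 <= W n w) ->
  (\int[P]_w stopping W alpha w <= \sum_(n <oo) P (A n) + N%:R%:E)%E.
Proof.
move=> mA hA; pose S w := (\sum_(n <oo) (\1_(A n) w : R)%:E)%E.
have ind0 w n : (0 <= (\1_(A n) w : R)%:E)%E by rewrite lee_fin.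
have mI n : measurable_fun setT (fun w => (\1_(A n) w : R)%:E).
  by apply/measurable_EFinP; exact: measurable_indic.
have S_ge w K : (forall k, (N <= k < N + K)%N -> A k w) ->
    (K%:R%:E <= S w)%E.
  move=> hK; apply: le_trans (nneseries_lim_ge (N + K) _); last first.
    by move=> *; exact: ind0.
  rewrite (big_cat_nat (leq0n N) (leq_addr K N))/=.
  rewrite -[leLHS]add0e; apply: leeD.
    by apply: sume_ge0 => n _; exact: ind0.
  rewrite (eq_big_nat _ _ (F2 := fun=> 1%E)); last first.
    by move=> k kK; rewrite indicE mem_set//; exact: hK.
  by rewrite sumEFin lee_fin sumr_const_nat addKn.
have stop_le w : (stopping W alpha w <= S w + N%:R%:E)%E.
  have [[n Nn nA]|allA] := pselect (exists2 n, (N <= n)%N & ~ A n w).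
    pose p k := (N <= k)%N && ~~ `[< A k w >].
    have exp : exists k, p k by exists n; rewrite /p Nn; apply/asboolPn.
    case: (ex_minnP exp) => k /andP[Nk /asboolPn nAk] kmin.
    apply: (@le_trans _ _ (k%:R%:E)).
      by apply: ereal_inf_lbound; exists k => //; exact: hA nAk.
    rewrite -(subnK Nk) natrD EFinD leeD2r//; apply: S_ge => j /andP[Nj jk].
    apply: contrapT => nAj; have : p j by rewrite /p Nj; apply/asboolPn.
    by move/kmin; rewrite leqNgt -[X in (_ < X)%N](subnKC Nk) jk.
  have -> : S w = +oo%E.
    apply/eqyP => a a0; apply: (le_trans _ (S_ge w (Num.bound a) _)).
      by rewrite lee_fin ltW// archi_boundP// ltW.
    by move=> k /andP[Nk _]; apply: contrapT => nA; apply: allA; exists k.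
  by rewrite addye// leey.
apply: (@le_trans _ _ (\int[P]_w (S w + N%:R%:E))%E).
  apply: ge0_integral_mono => // w; apply: le_ereal_inf_tmp => _ [n _ <-].
  by rewrite lee_fin.
have mS : measurable_fun setT S by exact: ge0_emeasurable_sum.
rewrite ge0_integralD//; last first.
- by move=> w _; apply: nneseries_ge0.
apply: leeD; last first.
  rewrite integral_cst// -[leRHS]mule1.
  apply: lee_wpmul2l; first by rewrite lee_fin.
  exact: probability_le1.
rewrite integral_nneseries//; apply: lee_nneseries => [n _ _|n _].
  by apply: integral_ge0 => w _; exact: ind0.
by rewrite integral_indic// setIT.
Qed.

End Events.

Theorem theorem2p9 (R : realType) (disp : measure_display)
  (T : measurableType disp) (P : probability T R)
  (F : nat -> set (set T)) (hF : filtration F)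
  (d : nat) (hd : (1 <= d)%N)
  (D : set 'cV[R]_d) (hD : has_ubound [set norm2 x | x in D])
  (hB : norm_bound D <= 1)
  (X : nat -> T -> 'cV[R]_d)
  (hXadapted : forall t, measurable_vec_wrt (F t) (X t))
  (hXD : forall t w, D (X t w))
  (gamma : nat -> T -> R)
  (hgamma : forall n, (1 <= n)%N -> measurable_wrt (F n.-1) (gamma n))
  (hgamma_range : forall n w, (1 <= n)%N -> - 2^-1 <= gamma n w <= 2^-1)
  (eta : nat -> T -> 'cV[R]_d)
  (heta : forall n, (1 <= n)%N -> measurable_vec_wrt (F n.-1) (eta n))
  (heta_range : forall n w, (1 <= n)%N -> dual_ball (norm_bound D) (eta n w))
  (EX : nat -> T -> 'cV[R]_d)
  (hEX : forall t, (1 <= t)%N -> is_condexp_vec P (F t.-1) (X t) (EX t))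
  (EX2 : nat -> T -> R)
  (hEX2 : forall t, (1 <= t)%N ->
     is_condexp P (F t.-1) (fun w => norm2 (X t w) ^+ 2) (EX2 t))
  (EetaX : nat -> T -> R)
  (hEetaX : forall t, (1 <= t)%N ->
     is_condexp P (F t.-1) (fun w => dotv (eta t w) (X t w)) (EetaX t))
  (r s m v : nat -> R)
  (hr : forall n, (1 <= n)%N -> 0 <= r n)
  (hs : forall n, (1 <= n)%N -> 0 <= s n)
  (hm : forall n, (1 <= n)%N -> 0 <= m n)
  (hv : forall n, (1 <= n)%N -> 0 <= v n) :
  let W := wealth X eta gamma in
  let rho := (\sum_(1 <= n <oo) P [set w | (r n < regret X eta gamma n w)%R])%E in
  let sigma := (\sum_(1 <= n <oo)
    P [set w | (s n < stoch_regret EX EetaX (norm_bound D) n w)%R])%E in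
  let varrho := (\sum_(1 <= n <oo)
    P [set w | (mean_norm EX n w < m n)%R \/ (v n < mean_sq EX2 n w)%R])%E in
  let u := log_growth r s m v in
  let bound := (rho + varrho + sigma + (pi ^+ 2 / 3)%R%:E)%E in
  (rho < +oo)%E -> (sigma < +oo)%E -> (varrho < +oo)%E ->
  [/\ (\sum_(1 <= n <oo) P [set w | (ln (W n w) < u n)%R] <= bound)%E,
      (bound < +oo)%E,
      (\forall n \near \oo, 0 < u n) ->
        {ae P, forall w, (1 <= limn_einf (fun n => (ln (W n w) / u n)%R%:E))%E}
    & forall alpha : R, 0 < alpha < 1 ->
        (\int[P]_w stopping W alpha w <= bound + aleph u (ln alpha^-1))%E].
Proof.
move=> W rho sigma varrho u bound rho_fin sigma_fin varrho_fin.
pose B := norm_bound D.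
have XB t w : norm2 (X t w) <= B.
  by apply: ub_le_sup => //; exists (X t w).
have X1 t w : (1 <= t)%N -> `|dotv (eta t w) (X t w)| <= 1.
  by move=> t1; exact: (normr_bet_le1 XB heta_range).
(* Emptied at time 0, so that series and almost sure statements can range over
   all times. *)
pose A := fun n => [set w | (1 <= n)%N /\ (ln (W n w) < u n)%R].
have mbad n : measurable [set w | (ln (W n w) < u n)%R].
  exact: (measurable_ln_wealth_lt hF hXadapted hgamma heta).
have AE n : A n = if (1 <= n)%N then [set w | (ln (W n w) < u n)%R] else set0.
  case: ifPn => n1; apply/seteqP; split=> w //=; first by case.
  by case; rewrite (negPf n1).
have mA n : measurable (A n) by rewrite AE; case: ifPn.
have sumA : (\sum_(n <oo) P (A n) =
    \sum_(1 <= n <oo) P [set w | (ln (W n w) < u n)%R])%E.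
  rewrite nneseries1E; congr (limn _); apply/funext => k.
  by apply: eq_bigr => n _; rewrite AE; case: ifPn => // _; rewrite measure0.
have sum_le : (\sum_(1 <= n <oo) P [set w | (ln (W n w) < u n)%R] <= bound)%E.
  pose evR n := P [set w | (r n < regret X eta gamma n w)%R].
  pose evS n := P [set w | (s n < stoch_regret EX EetaX B n w)%R].
  pose evV n :=
    P [set w | (mean_norm EX n w < m n)%R \/ (v n < mean_sq EX2 n w)%R].
  pose sq n : \bar R := ((n%:R ^+ 2)^-1)%:E.
  have sq0 n : (0 <= sq n)%E by rewrite lee_fin invr_ge0 sqr_ge0.
  apply: (@le_trans _ _ (\sum_(1 <= n <oo) (evR n + evV n + evS n + sq n))%E).
    apply: lee_nneseries1 => // n n1.
    exact: (prob_ln_wealth_lt_le hF hXadapted XB hB hgamma hgamma_range heta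
      heta_range hEX hEX2 hEetaX n1 (hr n n1) (hs n n1) (hm n n1) (hv n n1)).
  have evR0 n : (0 <= evR n)%E by exact: measure_ge0.
  have evS0 n : (0 <= evS n)%E by exact: measure_ge0.
  have evV0 n : (0 <= evV n)%E by exact: measure_ge0.
  rewrite nneseriesD//; last by move=> n _ _; rewrite !adde_ge0.
  rewrite nneseriesD//; last by move=> n _ _; rewrite adde_ge0.
  rewrite nneseriesD//.
  by apply: leeD => //; exact: nneseries_inv_square_le.
have bound_fin : (bound < +oo)%E by rewrite /bound !lte_add_pinfty// ltry.
split=> //.
- move=> [N0 _ u0].
  have /ae_eventually_not -/(_ mA) : (\sum_(n <oo) P (A n) < +oo)%E.
    by rewrite sumA (le_lt_trans sum_le).
  apply: filterS => w [N1 _ nbad]; apply: limn_einf_ge1.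
  exists (maxn 1 (maxn N0 N1)) => // n /=.
  rewrite !geq_max => /and3P[n1 nN0 nN1].
  have un := u0 n nN0; rewrite ler_pdivlMr// mul1r leNgt; apply/negP => lt_u.
  by apply: (nbad n nN1); split.
- move=> alpha /andP[alpha0 alpha1].
  have bound0 : (0 <= bound)%E.
    by apply: le_trans sum_le; apply: nneseries_ge0.
  have bound_num : bound \is a fin_num by rewrite ge0_fin_numE.
  rewrite -leeBlDl//; apply: le_ereal_inf_tmp => _ [N [N1 uN] <-].
  rewrite leeBlDl//.
  apply: (@le_trans _ _ (\sum_(n <oo) P (A n) + N%:R%:E)%E).
    apply: integral_stopping_le => // n w Nn nA.
    have Wn : 0 < W n w by apply: wealth_gt0 => // t t1; exact: hgamma_range.
    rewrite -ler_ln ?posrE ?invr_gt0//.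
    apply: (@le_trans _ _ (u n)).
      rewrite -lee_fin; apply: le_trans uN _.
      by apply: ereal_inf_lbound; exists n.
    rewrite leNgt; apply/negP => lt_u; apply: nA; split=> //.
    exact: leq_trans Nn.
  by rewrite sumA leeD2r.
Qed.
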